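(* Let $D$ be a quasi-stable domain. Then $D$ is locally quasi-stable, i.e. $D_P$ is quasi-stable for each prime ideal $P\in\operatorname{Spec}(D)$.
   Context: ''Ideal'' of a domain means fractional ideal: for a domain $R$ with quotient field $K$, an $R$-submodule $I$ of $K$ with $dI\subseteq R$ for some nonzero $d\in R$. For a nonzero ideal $I$ of $R$, $(I:I)=\{x\in K\mid xI\subseteq I\}$, a ring between $R$ and $K$; $I$ is quasi-stable if $I$ is flat as an $(I:I)$-module. A domain is quasi-stable if each of its nonzero ideals is quasi-stable. *)

(* Defs.v *)
From HB Require Import structures.
From mathcomp Require Import all_boot all_order all_algebra.
From mathcomp Require Import generic_quotient ring_quotient fraction.
From mathcomp Require Import boolp.

Set Implicit Arguments.
Unset Strict Implicit.
Unset Printing Implicit Defensive.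

Import GRing.Theory.
Local Open Scope ring_scope.
Local Open Scope quotient_scope.

(* The tensor product M (x) N of two modules over a commutative ring: formal
   sums of pairs (m, n), represented by finite sequences, modulo the congruence
   generated by the bilinearity relations. *)
Section TensorProduct.
Variables (A : comNzRingType) (M N : lmodType A).

Inductive tensor_rel : seq (M * N) -> seq (M * N) -> Prop :=
| tensor_refl s : tensor_rel s s
| tensor_sym s t : tensor_rel s t -> tensor_rel t s
| tensor_trans s t u : tensor_rel s t -> tensor_rel t u -> tensor_rel s u
| tensor_cat s s' t t' :
    tensor_rel s s' -> tensor_rel t t' -> tensor_rel (s ++ t) (s' ++ t')
| tensor_comm s t : tensor_rel (s ++ t) (t ++ s)
| tensor_0l n : tensor_rel [:: (0, n)] [::]
| tensor_Dl m m' n : tensor_rel [:: (m + m', n)] [:: (m, n); (m', n)]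
| tensor_Dr m n n' : tensor_rel [:: (m, n + n')] [:: (m, n); (m, n')]
| tensor_Z a m n : tensor_rel [:: (a *: m, n)] [:: (m, a *: n)].

Definition tensor_eqv : rel (seq (M * N)) := fun s t => `[< tensor_rel s t >].

Lemma tensor_eqv_refl : reflexive tensor_eqv.
Proof. by move=> s; apply/asboolP; exact: tensor_refl. Qed.

Lemma tensor_eqv_sym : symmetric tensor_eqv.
Proof. by move=> s t; apply/asboolP/asboolP; exact: tensor_sym. Qed.

Lemma tensor_eqv_trans : transitive tensor_eqv.
Proof.
by move=> t s u /asboolP st /asboolP tu; apply/asboolP; exact: tensor_trans tu.
Qed.

Canonical tensor_equiv :=
  EquivRel tensor_eqv tensor_eqv_refl tensor_eqv_sym tensor_eqv_trans.

Definition tensor : Type := {eq_quot tensor_eqv}.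
HB.instance Definition _ := Choice.on tensor.
HB.instance Definition _ := EqQuotient.on tensor.

Definition tensor_class (s : seq (M * N)) : tensor :=
  \pi_({eq_quot tensor_eqv}) s.

Lemma tensor_classW (P : tensor -> Prop) :
  (forall s, P (tensor_class s)) -> forall x, P x.
Proof. exact: quotW. Qed.

Lemma tensor_classP s t : tensor_class s = tensor_class t <-> tensor_rel s t.
Proof.
split=> [/eqP|st]; first by rewrite eqmodE => /asboolP.
by apply/eqP; rewrite eqmodE; apply/asboolP.
Qed.

Lemma tensor_class_eq s t : tensor_rel s t -> tensor_class s = tensor_class t.
Proof. by move/tensor_classP. Qed.

Lemma tensor_reprK s : tensor_rel (repr (tensor_class s)) s.
Proof. by apply/tensor_classP; exact: reprK. Qed.

End TensorProduct.

Lemma tensor_rel_map (A : comNzRingType) (M N M' N' : lmodType A)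
    (f : {linear M -> M'}) (g : {linear N -> N'}) s t :
  tensor_rel s t ->
  tensor_rel [seq (f p.1, g p.2) | p <- s] [seq (f p.1, g p.2) | p <- t].
Proof.
elim=> {s t}.
- by move=> s; exact: tensor_refl.
- by move=> s t _; exact: tensor_sym.
- by move=> s t u _ + _; exact: tensor_trans.
- by move=> s s' t t' _ + _; rewrite !map_cat; exact: tensor_cat.
- by move=> s t; rewrite !map_cat; exact: tensor_comm.
- by move=> n /=; rewrite raddf0; exact: tensor_0l.
- by move=> m m' n /=; rewrite raddfD; exact: tensor_Dl.
- by move=> m n n' /=; rewrite raddfD; exact: tensor_Dr.
- by move=> a m n /=; rewrite !linearZ; exact: tensor_Z.
Qed.

Section TensorModule.
Variables (A : comNzRingType) (M N : lmodType A).
Local Notation T := (tensor M N).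

Definition tensor_zero : T := tensor_class [::].
Definition tensor_add (x y : T) : T := tensor_class (repr x ++ repr y).
Definition tensor_scale (a : A) (x : T) : T :=
  tensor_class [seq (a *: p.1, p.2) | p <- repr x].
Definition tensor_opp (x : T) : T :=
  tensor_class [seq (- p.1, p.2) | p <- repr x].

Lemma tensor_addE s t :
  tensor_add (tensor_class s) (tensor_class t) = tensor_class (s ++ t).
Proof. by apply: tensor_class_eq; apply: tensor_cat; exact: tensor_reprK. Qed.

Lemma tensor_scaleE a s :
  tensor_scale a (tensor_class s) = tensor_class [seq (a *: p.1, p.2) | p <- s].
Proof.
apply: tensor_class_eq; apply: (@tensor_rel_map A M N M N ( *:%R a) idfun).
exact: tensor_reprK.
Qed.

Lemma tensor_oppE s :
  tensor_opp (tensor_class s) = tensor_class [seq (- p.1, p.2) | p <- s].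
Proof.
apply: tensor_class_eq; apply: (@tensor_rel_map A M N M N -%R idfun).
exact: tensor_reprK.
Qed.

Lemma tensor_addA : associative tensor_add.
Proof.
move=> x y z; elim/tensor_classW: x => s; elim/tensor_classW: y => t.
elim/tensor_classW: z => u.
rewrite (tensor_addE t) (tensor_addE s) (tensor_addE s) (tensor_addE _ u).
by rewrite catA.
Qed.

Lemma tensor_addC : commutative tensor_add.
Proof.
move=> x y; elim/tensor_classW: x => s; elim/tensor_classW: y => t.
rewrite (tensor_addE s) (tensor_addE t).
by apply: tensor_class_eq; exact: tensor_comm.
Qed.

Lemma tensor_add0 : left_id tensor_zero tensor_add.
Proof. by move=> x; elim/tensor_classW: x => s; rewrite tensor_addE. Qed.

Lemma tensor_addN : left_inverse tensor_zero tensor_opp tensor_add.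
Proof.
have add_cons p s :
    tensor_class (p :: s) = tensor_add (tensor_class [:: p]) (tensor_class s).
  by rewrite (tensor_addE [:: p]).
move=> x; elim/tensor_classW: x => s; rewrite (tensor_oppE s).
elim: s => [|[m n] s IHs] /=; first by rewrite (tensor_addE [::] [::]).
rewrite (add_cons (- m, n)) (add_cons (m, n)).
set u := tensor_class [:: (- m, n)]; set v := tensor_class [:: (m, n)].
rewrite -tensor_addA (tensor_addC v) (tensor_addA _ _ v) IHs tensor_add0.
rewrite (tensor_addE [:: _] [:: _]) /= -(tensor_class_eq (tensor_Dl (- m) m n)).
by rewrite addNr; apply: tensor_class_eq; exact: tensor_0l.
Qed.

HB.instance Definition _ :=
  GRing.isZmodule.Build T tensor_addA tensor_addC tensor_add0 tensor_addN.

Lemma tensor_classD s t :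
  tensor_class (s ++ t) = tensor_class s + tensor_class t :> T.
Proof. by rewrite [RHS]tensor_addE. Qed.

Lemma tensor_scaleA a b x :
  tensor_scale a (tensor_scale b x) = tensor_scale (a * b) x.
Proof.
elim/tensor_classW: x => s.
rewrite (tensor_scaleE b s) (tensor_scaleE a) (tensor_scaleE _ s) -map_comp.
by congr tensor_class; apply: eq_map => p /=; rewrite scalerA.
Qed.

Lemma tensor_scale1 : left_id 1 tensor_scale.
Proof.
move=> x; elim/tensor_classW: x => s; rewrite (tensor_scaleE 1 s).
rewrite -[in RHS](map_id s); congr tensor_class.
by apply: eq_map => -[m n] /=; rewrite scale1r.
Qed.

Lemma tensor_scaleDr : right_distributive tensor_scale +%R.
Proof.
move=> a x y; elim/tensor_classW: x => s; elim/tensor_classW: y => t.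
rewrite -tensor_classD (tensor_scaleE a s) (tensor_scaleE a t).
by rewrite (tensor_scaleE a (s ++ t)) map_cat tensor_classD.
Qed.

Lemma tensor_scaleDl x : {morph tensor_scale^~ x : a b / a + b}.
Proof.
move=> a b; elim/tensor_classW: x => s.
rewrite (tensor_scaleE _ s) (tensor_scaleE a s) (tensor_scaleE b s).
elim: s => [|[m n] s IHs] /=; first by rewrite -tensor_classD.
rewrite -cat1s -(cat1s (a *: m, n)) -(cat1s (b *: m, n)) !tensor_classD IHs.
rewrite addrACA; congr (_ + _); rewrite scalerDl -tensor_classD.
by apply: tensor_class_eq; exact: tensor_Dl.
Qed.

HB.instance Definition _ := GRing.Zmodule_isLmodule.Build A T
  tensor_scaleA tensor_scale1 tensor_scaleDr tensor_scaleDl.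

Lemma tensor_classZ a s :
  tensor_class [seq (a *: p.1, p.2) | p <- s] = a *: tensor_class s :> T.
Proof. by rewrite [RHS]tensor_scaleE. Qed.

Definition pure_tensor (m : M) (n : N) : T := tensor_class [:: (m, n)].

Lemma tensor_class_sum s :
  tensor_class s = \sum_(p <- s) pure_tensor p.1 p.2.
Proof.
elim: s => [|[m n] s IHs]; first by rewrite big_nil.
by rewrite big_cons -IHs -tensor_classD.
Qed.

Lemma pure_tensorPl n : linear (pure_tensor^~ n).
Proof.
move=> a m m'; rewrite [LHS](tensor_class_eq (tensor_Dl _ _ _)).
by rewrite -tensor_classZ -tensor_classD.
Qed.

Lemma pure_tensorPr m : linear (pure_tensor m).
Proof.
move=> a n n'; rewrite [LHS](tensor_class_eq (tensor_Dr _ _ _)).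
rewrite -(cat1s (m, _)) tensor_classD -(tensor_class_eq (tensor_Z _ _ _)).
by rewrite -tensor_classZ.
Qed.

Lemma tensor_universal (U : lmodType A) (b : M -> N -> U) :
    (forall n, linear (b^~ n)) -> (forall m, linear (b m)) ->
  exists g : {linear T -> U},
    (forall m n, g (pure_tensor m n) = b m n) /\
    (forall h : {linear T -> U},
      (forall m n, h (pure_tensor m n) = b m n) -> h =1 g).
Proof.
move=> bl br.
have bZl a m n : b (a *: m) n = a *: b m n.
  exact: (scalable_linear (bl n)).
have bZr a m n : b m (a *: n) = a *: b m n.
  exact: (scalable_linear (br m)).
have bDl m m' n : b (m + m') n = b m n + b m' n.
  by have := bl n 1 m m'; rewrite !scale1r.
have bDr m n n' : b m (n + n') = b m n + b m n'.
  by have := br m 1 n n'; rewrite !scale1r.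
pose F (s : seq (M * N)) : U := \sum_(p <- s) b p.1 p.2.
have FP s t : tensor_rel s t -> F s = F t.
  rewrite /F; elim=> {s t} //.
  - by move=> s t u _ -> _.
  - by move=> s s' t t' _ h _ h'; rewrite !big_cat /= h h'.
  - by move=> s t; rewrite !big_cat /= addrC.
  - by move=> n; rewrite big_seq1 big_nil -[0](scale0r 0) bZl scale0r.
  - by move=> m m' n; rewrite !big_cons !big_nil !addr0 bDl.
  - by move=> m n n'; rewrite !big_cons !big_nil !addr0 bDr.
  - by move=> a m n; rewrite !big_seq1 bZl bZr.
pose g0 (x : T) : U := F (repr x).
have g0E s : g0 (tensor_class s) = F s by apply: FP; exact: tensor_reprK.
have lg0 : linear g0.
  move=> a x y; elim/tensor_classW: x => s; elim/tensor_classW: y => t.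
  rewrite -tensor_classZ -tensor_classD !g0E /F big_cat big_map /=.
  by rewrite scaler_sumr; congr (_ + _); apply: eq_bigr.
pose g : {linear T -> U} :=
  HB.pack g0 (GRing.isLinear.Build A T U *:%R g0 lg0).
exists g; split=> [m n|h hE x]; last first.
  elim/tensor_classW: x => s; rewrite [RHS](g0E s) tensor_class_sum raddf_sum.
  by apply: eq_bigr => p _; exact: hE.
by transitivity (F [:: (m, n)]); [exact: g0E | rewrite /F big_seq1].
Qed.

End TensorModule.

Section TensorMap.
Variables (A : comNzRingType) (M N N' : lmodType A) (f : {linear N -> N'}).

(* The map id (x) f : M (x) N -> M (x) N'. *)
Definition tensor_map (x : tensor M N) : tensor M N' :=
  tensor_class [seq (p.1, f p.2) | p <- repr x].

Lemma tensor_mapE s :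
  tensor_map (tensor_class s) = tensor_class [seq (p.1, f p.2) | p <- s].
Proof.
apply: tensor_class_eq; apply: (@tensor_rel_map A M N M N' idfun f).
exact: tensor_reprK.
Qed.

Lemma tensor_map_pure m n :
  tensor_map (pure_tensor m n) = pure_tensor m (f n).
Proof. exact: (tensor_mapE [:: (m, n)]). Qed.

Lemma tensor_map_is_linear : linear tensor_map.
Proof.
move=> a x y; elim/tensor_classW: x => s; elim/tensor_classW: y => t.
rewrite -tensor_classZ -tensor_classD !tensor_mapE -tensor_classZ.
by rewrite -tensor_classD map_cat -!map_comp.
Qed.

HB.instance Definition _ := GRing.isLinear.Build A (tensor M N) (tensor M N')
  *:%R tensor_map tensor_map_is_linear.

End TensorMap.
Arguments tensor_map {A} M {N N'} f x.

Definition flat (A : comNzRingType) (M : lmodType A) : Prop :=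
  forall (N N' : lmodType A) (f : {linear N -> N'}),
    injective f -> injective (tensor_map M f).

Section FractionalIdeal.
Variable R : idomainType.
Local Notation K := {fraction R}.

(* Fractional ideals of R inside K = {fraction R}; tofrac is the embedding of R
   into K. The zero ideal is included. *)
Record frac_ideal := FracIdeal {
  frac_ideal_set :> K -> Prop;
  frac_ideal0 : frac_ideal_set 0;
  frac_idealD x y :
    frac_ideal_set x -> frac_ideal_set y -> frac_ideal_set (x + y);
  frac_idealZ (a : R) x : frac_ideal_set x -> frac_ideal_set (tofrac a * x);
  frac_ideal_denom :
    exists2 d : R, d != 0 &
      forall x, frac_ideal_set x -> exists r : R, tofrac d * x = tofrac r
}.

Definition nonzero_ideal (I : frac_ideal) : Prop := exists2 x, I x & x != 0.

Section ColonRing.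
Variable I : frac_ideal.

Lemma frac_idealB x y : I x -> I y -> I (x - y).
Proof.
move=> Ix Iy; apply: frac_idealD => //.
by rewrite -mulN1r -[1](rmorph1 (@tofrac R)) -rmorphN; exact: frac_idealZ.
Qed.

(* (I : I) = {x in K | x I is included in I}. The types colon_ring and
   ideal_module carry (I : I) and I themselves, with operations induced by K. *)
Definition colon_pred : {pred K} :=
  fun x => `[< forall y, I y -> I (x * y) >].

Lemma colon_pred_subring : subring_closed colon_pred.
Proof.
split.
- by apply/asboolP => y Iy; rewrite mul1r.
- move=> x y /asboolP Ix /asboolP Iy; apply/asboolP => z Iz.
  by rewrite mulrBl; apply: frac_idealB; [exact: Ix | exact: Iy].
- move=> x y /asboolP Ix /asboolP Iy; apply/asboolP => z Iz.
  by rewrite -mulrA; apply: Ix; exact: Iy.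
Qed.

HB.instance Definition _ :=
  GRing.isSubringClosed.Build K colon_pred colon_pred_subring.

Definition colon_ring : Type := {x : K | colon_pred x}.
HB.instance Definition _ := SubChoice.on colon_ring.
HB.instance Definition _ := [SubChoice_isSubComNzRing of colon_ring by <:].

Definition ideal_pred : {pred K} := fun x => `[< I x >].

Lemma ideal_pred_zmod : zmod_closed ideal_pred.
Proof.
split; first by apply/asboolP; exact: frac_ideal0.
by move=> x y /asboolP Ix /asboolP Iy; apply/asboolP; exact: frac_idealB.
Qed.

HB.instance Definition _ :=
  GRing.isZmodClosed.Build K ideal_pred ideal_pred_zmod.

Definition ideal_module : Type := {x : K | ideal_pred x}.
HB.instance Definition _ := SubChoice.on ideal_module.
HB.instance Definition _ := [SubChoice_isSubZmodule of ideal_module by <:].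

Lemma colon_mul_subproof (a : colon_ring) (x : ideal_module) :
  ideal_pred (val a * val x).
Proof.
by apply/asboolP; have /asboolP := valP a; apply; apply/asboolP; exact: valP x.
Qed.

Definition colon_scale (a : colon_ring) (x : ideal_module) : ideal_module :=
  Sub (val a * val x) (colon_mul_subproof a x).

Lemma val_colon_scale a x : val (colon_scale a x) = val a * val x.
Proof. exact: SubK. Qed.

Lemma colon_scaleA a b x :
  colon_scale a (colon_scale b x) = colon_scale (a * b) x.
Proof.
by apply: val_inj; rewrite (val_colon_scale a) !val_colon_scale rmorphM mulrA.
Qed.

Lemma colon_scale1 : left_id 1 colon_scale.
Proof. by move=> x; apply: val_inj; rewrite val_colon_scale rmorph1 mul1r. Qed.

Lemma val_ideal_moduleD (x y : ideal_module) : val (x + y) = val x + val y.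
Proof. exact: raddfD. Qed.

Lemma colon_scaleDr : right_distributive colon_scale +%R.
Proof.
move=> a x y; apply: val_inj; rewrite val_ideal_moduleD !val_colon_scale.
by rewrite val_ideal_moduleD mulrDr.
Qed.

Lemma colon_scaleDl x : {morph colon_scale^~ x : a b / a + b}.
Proof.
move=> a b; apply: val_inj; rewrite val_ideal_moduleD !val_colon_scale.
by rewrite raddfD mulrDl.
Qed.

HB.instance Definition _ :=
  GRing.Zmodule_isLmodule.Build colon_ring ideal_module
    colon_scaleA colon_scale1 colon_scaleDr colon_scaleDl.

Definition quasi_stable_ideal : Prop :=
  flat (ideal_module : lmodType colon_ring).

End ColonRing.

Definition quasi_stable : Prop :=
  forall I : frac_ideal, nonzero_ideal I -> quasi_stable_ideal I.

End FractionalIdeal.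

(* The prime ideals are those of ring_quotient (proper, possibly zero). They are
   boolean predicates, which loses no generality since asbool turns any
   Prop-valued predicate into a boolean one. *)
Section Localization.
Variables (R : idomainType) (P : prime_idealr R).
Local Notation K := {fraction R}.

(* R_P, realised inside the quotient field of R *)
Definition local_pred : {pred K} :=
  fun x => `[< exists a s : R, s \notin P /\ x = tofrac a / tofrac s >].

Lemma local_denom_neq0 s : s \notin P -> tofrac s != 0 :> K.
Proof.
by apply: contraNneq => /eqP; rewrite tofrac_eq0 => /eqP ->; exact: idealr0.
Qed.

Lemma local_pred_subring : subring_closed local_pred.
Proof.
have P1 : (1 : R) \notin P by rewrite idealr1.
have PM s t : s \notin P -> t \notin P -> s * t \notin P.
  by move=> Ps Pt; rewrite prime_idealrM negb_or Ps Pt.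
split.
- by apply/asboolP; exists 1, 1; split=> //; rewrite rmorph1 divr1.
- move=> x y /asboolP[a [s [Ps ->]]] /asboolP[b [t [Pt ->]]]; apply/asboolP.
  exists (a * t - b * s), (s * t); split; first exact: PM.
  rewrite rmorphB !rmorphM -[- (tofrac b / tofrac t)]mulNr.
  by rewrite addf_div ?local_denom_neq0 // mulNr.
- move=> x y /asboolP[a [s [Ps ->]]] /asboolP[b [t [Pt ->]]]; apply/asboolP.
  exists (a * b), (s * t); split; first exact: PM.
  by rewrite !rmorphM mulf_div.
Qed.

HB.instance Definition _ :=
  GRing.isSubringClosed.Build K local_pred local_pred_subring.

Definition localization : Type := {x : K | local_pred x}.
HB.instance Definition _ := SubChoice.on localization.
HB.instance Definition _ := [SubChoice_isSubComNzRing of localization by <:].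

Lemma val_localM (x y : localization) : val (x * y) = val x * val y.
Proof. exact: rmorphM. Qed.

Lemma val_local1 : val (1 : localization) = 1.
Proof. exact: rmorph1. Qed.

Lemma val_local0 : val (0 : localization) = 0.
Proof. exact: rmorph0. Qed.

(* An idomainType needs a decided unit predicate and a total inverse; elements
   of R_P that are not units of R_P are sent to themselves. *)
Definition local_unit : {pred localization} :=
  fun x => (val x != 0) && local_pred (val x)^-1.

Definition local_inv (x : localization) : localization :=
  if local_unit x then insubd x (val x)^-1 else x.

Lemma local_mulVx : {in local_unit, left_inverse 1 local_inv *%R}.
Proof.
move=> x ux; apply: val_inj; rewrite val_localM val_local1 /local_inv.
rewrite -[local_unit x]/(x \in local_unit) ux; case/andP: ux => x0 px.
by rewrite val_insubd px mulVf.
Qed.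

Lemma local_unitPl x y : y * x = 1 -> local_unit x.
Proof.
move=> /(congr1 val); rewrite val_localM val_local1 => yx.
have x0 : val x != 0.
  by apply: contra_eq_neq yx => ->; rewrite mulr0 eq_sym oner_neq0.
apply/andP; split=> //; rewrite -[_^-1]mul1r -yx mulfK //; exact: valP y.
Qed.

Lemma local_inv_out : {in [predC local_unit], local_inv =1 id}.
Proof.
by move=> x /negbTE ux; rewrite /local_inv -[local_unit x]/(x \in local_unit) ux.
Qed.

HB.instance Definition _ := GRing.ComNzRing_hasMulInverse.Build localization
  local_mulVx local_unitPl local_inv_out.

Lemma local_idomain : GRing.integral_domain_axiom localization.
Proof.
move=> x y /(congr1 val); rewrite val_localM val_local0 => /eqP.
by rewrite mulf_eq0 -val_local0 !(inj_eq val_inj).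
Qed.

HB.instance Definition _ :=
  GRing.ComUnitRing_isIntegral.Build localization local_idomain.

End Localization.

(* Main.v *)
Require Import Defs.
From HB Require Import structures.
From mathcomp Require Import all_boot all_order all_algebra.
From mathcomp Require Import ring.
From mathcomp Require Import generic_quotient ring_quotient fraction boolp.

(** Let J be a nonzero fractional ideal of the localization D_P, and choose
    d <> 0 with d J included in D_P. The contraction I of d J to D is a nonzero
    ideal of D, hence flat over A = (I : I), and I D_P = d J because every
    element of D_P is a quotient of an element of D by an element outside P.

    The ring A is contained in B = (J : J), but B may be strictly larger than
    the localization of A at P, so flatness of J does not follow by localizing.
    It follows from base change instead, once J is identified with the tensor
    product of I and B over A (flat_base_change). The natural map from that
    tensor product to J, sending x (x) c to c x / d, is onto because B contains
    D_P. For injectivity, embed B in the quotient field K. As I is flat over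
    A, the tensor product of I and B embeds in that of I and K, and the latter
    is one-dimensional over K: after clearing denominators every tensor is
    x0 (x) c for a fixed nonzero x0 in I (ideal_tensor_field). So the
    composite with the inclusion of J in K kills only 0.

    The argument only needs each element of J to be a (J : J)-multiple of an
    element of delta iota(I), where iota is a morphism of quotient fields and
    delta a nonzero constant; quasi_stable_ideal_transfer is stated for this
    situation. The quotient field of D_P is a type of its own, different from
    that of D, and fraction_extend supplies the morphism
    between them. *)

Set Implicit Arguments.
Unset Strict Implicit.
Unset Printing Implicit Defensive.

Import GRing.Theory.
Local Open Scope ring_scope.
Local Open Scope quotient_scope.

(** * Fraction fields *)

Lemma fractionP (R : idomainType) (x : {fraction R}) :
  exists n d : R, d != 0 /\ x = tofrac n / tofrac d.
Proof.
elim/quotW: x => x; exists \n_x, \d_x; have d0 := denom_ratioP x.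
split=> //; apply: (canRL (mulfK _)); first by rewrite tofrac_eq0.
unlock FracField.tofrac; rewrite -[LHS]FracField.pi_mul.
apply/eqmodP; rewrite /= /FracField.equivf /FracField.mulf.
by rewrite !numden_Ratio ?mulr1 ?oner_eq0 // mulrC.
Qed.

Lemma fraction_extend (R : idomainType) (F : fieldType)
    (f : {rmorphism R -> F}) : injective f ->
  exists g : {rmorphism {fraction R} -> F}, forall r, g (tofrac r) = f r.
Proof.
move=> f_inj.
have f_neq0 d : d != 0 -> f d != 0 by rewrite -(rmorph0 f) (inj_eq f_inj).
have num_den x : { p : R * R | p.2 != 0 & x = tofrac p.1 / tofrac p.2 }.
  apply: cid2; have [n [d [d0 ->]]] := fractionP x; by exists (n, d).
pose g0 x : F := f (s2val (num_den x)).1 / f (s2val (num_den x)).2.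
have g0E n d : d != 0 -> g0 (tofrac n / tofrac d) = f n / f d.
  (* Both fractions represent the same element, so they cross-multiply in R,
     and f carries this relation to F. *)
  rewrite /g0; case: (num_den _) => -[n' d'] /= d'0 /eqP e d0.
  apply/eqP; rewrite eqr_div ?f_neq0 // -!rmorphM (inj_eq f_inj) eq_sym.
  by move: e; rewrite eqr_div ?tofrac_eq0 // -!rmorphM tofrac_eq.
have g0_tofrac r : g0 (tofrac r) = f r.
  by rewrite -[tofrac r]divr1 -(rmorph1 (@tofrac R)) g0E ?oner_eq0 //
    rmorph1 divr1.
have g0B : zmod_morphism g0.
  move=> x y; have [n [d [d0 ->]]] := fractionP x.
  have [m [e [e0 ->]]] := fractionP y.
  rewrite !g0E // -!mulNr -!rmorphN !addf_div ?tofrac_eq0 ?f_neq0 //.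
  by rewrite -!rmorphM -!rmorphD g0E ?mulf_neq0.
have g0M : monoid_morphism g0.
  split; first by rewrite -[1](rmorph1 (@tofrac R)) g0_tofrac rmorph1.
  move=> x y; have [n [d [d0 ->]]] := fractionP x.
  have [m [e [e0 ->]]] := fractionP y.
  by rewrite !g0E // !mulf_div -!rmorphM g0E ?mulf_neq0.
pose g : {rmorphism {fraction R} -> F} := HB.pack g0
  (GRing.isZmodMorphism.Build _ _ g0 g0B)
  (GRing.isMonoidMorphism.Build _ _ g0 g0M).
by exists g.
Qed.

(** * Restriction of scalars *)

(** The scalar action of N over B is hidden behind an alias that remembers phi,
    so that the action of A through phi does not compete with it. *)
Definition restrict (A B : comNzRingType) (phi : {rmorphism A -> B})
  (N : lmodType B) : Type := N.

Section RestrictScalars.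
Variables (A B : comNzRingType) (phi : {rmorphism A -> B}).
Local Notation restrict := (restrict phi).

HB.instance Definition _ (N : lmodType B) := GRing.Zmodule.on (restrict N).

Section Module.
Variable N : lmodType B.

Definition restrict_scale (a : A) (x : restrict N) : restrict N :=
  phi a *: (x : N).

Lemma restrict_scaleA a b x :
  restrict_scale a (restrict_scale b x) = restrict_scale (a * b) x.
Proof. by rewrite /restrict_scale scalerA rmorphM. Qed.

Lemma restrict_scale1 : left_id 1 restrict_scale.
Proof. by move=> x; rewrite /restrict_scale rmorph1 scale1r. Qed.

Lemma restrict_scaleDr : right_distributive restrict_scale +%R.
Proof. by move=> a x y; rewrite /restrict_scale scalerDr. Qed.

Lemma restrict_scaleDl x : {morph restrict_scale^~ x : a b / a + b}.
Proof. by move=> a b; rewrite /restrict_scale rmorphD scalerDl. Qed.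

HB.instance Definition _ := GRing.Zmodule_isLmodule.Build A (restrict N)
  restrict_scaleA restrict_scale1 restrict_scaleDr restrict_scaleDl.

Lemma restrictZ (a : A) (x : restrict N) : a *: x = phi a *: (x : N).
Proof. by []. Qed.

End Module.

Section Map.
Variables (N N' : lmodType B) (f : {linear N -> N'}).

Definition restrict_map : restrict N -> restrict N' := f.

Lemma restrict_map_linear : linear restrict_map.
Proof. move=> a x y; exact: linearP. Qed.

HB.instance Definition _ := GRing.isLinear.Build A (restrict N) (restrict N')
  *:%R restrict_map restrict_map_linear.
End Map.

Section Orbit.
Variables (N : lmodType B) (n : N).

Definition orbit_map (b : restrict B^o) : restrict N := (b : B) *: n.

Lemma orbit_map_linear : linear orbit_map.
Proof. by move=> a x y; rewrite /orbit_map scalerDl -scalerA. Qed.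

HB.instance Definition _ := GRing.isLinear.Build A (restrict B^o) (restrict N)
  *:%R orbit_map orbit_map_linear.
End Orbit.

End RestrictScalars.

(** * Tensor products as abelian groups *)

Section TensorFacts.
Variables (A : comNzRingType) (M N : lmodType A).

Lemma tensor_pure_ind (P : tensor M N -> Prop) :
    P 0 -> (forall m n, P (pure_tensor m n)) ->
    (forall x y, P x -> P y -> P (x + y)) ->
  forall x, P x.
Proof.
move=> P0 Pp PD x; elim/tensor_classW: x => s; rewrite tensor_class_sum.
by elim/big_ind: _.
Qed.

(** The target is only an abelian group, which allows maps between tensor
    products over two different rings. *)
Lemma tensor_balanced (U : zmodType) (b : M -> N -> U) :
    (forall m m' n, b (m + m') n = b m n + b m' n) ->
    (forall m n n', b m (n + n') = b m n + b m n') ->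
    (forall a m n, b (a *: m) n = b m (a *: n)) ->
  exists g : {additive tensor M N -> U},
    forall m n, g (pure_tensor m n) = b m n.
Proof.
move=> bDl bDr bZ.
pose S (s : seq (M * N)) : U := \sum_(p <- s) b p.1 p.2.
have S_rel s t : tensor_rel s t -> S s = S t.
  rewrite /S; elim=> {s t} //.
  - by move=> s t u _ -> _.
  - by move=> s s' t t' _ ss' _ tt'; rewrite !big_cat /= ss' tt'.
  - by move=> s t; rewrite !big_cat /= addrC.
  - move=> n; rewrite big_seq1 big_nil /=; apply: (addIr (b 0 n)).
    by rewrite -bDl addr0 add0r.
  - by move=> m m' n; rewrite !big_cons !big_nil !addr0 bDl.
  - by move=> m n n'; rewrite !big_cons !big_nil !addr0 bDr.
  - by move=> a m n; rewrite !big_seq1 bZ.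
pose g0 (x : tensor M N) : U := S (repr x).
have g0E s : g0 (tensor_class s) = S s by apply: S_rel; exact: tensor_reprK.
have g0D : {morph g0 : x y / x + y}.
  move=> x y; elim/tensor_classW: x => s; elim/tensor_classW: y => t.
  by rewrite -tensor_classD !g0E /S big_cat.
have g0B : zmod_morphism g0.
  by move=> x y; apply: (addIr (g0 y)); rewrite -g0D !subrK.
pose g : {additive tensor M N -> U} :=
  HB.pack g0 (GRing.isZmodMorphism.Build _ _ g0 g0B).
exists g => m n; transitivity (S [:: (m, n)]); first exact: g0E.
by rewrite /S big_seq1.
Qed.

Lemma pure_tensorDl (m m' : M) (n : N) :
  pure_tensor (m + m') n = pure_tensor m n + pure_tensor m' n.
Proof. by have := pure_tensorPl n 1 m m'; rewrite !scale1r. Qed.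

Lemma pure_tensorDr (m : M) (n n' : N) :
  pure_tensor m (n + n') = pure_tensor m n + pure_tensor m n'.
Proof. by have := pure_tensorPr m 1 n n'; rewrite !scale1r. Qed.

Lemma pure_tensor0l (n : N) : pure_tensor (0 : M) n = 0.
Proof. by apply: (addIr (pure_tensor 0 n)); rewrite -pure_tensorDl !add0r. Qed.

Lemma pure_tensor0r (m : M) : pure_tensor m (0 : N) = 0.
Proof. by apply: (addIr (pure_tensor m 0)); rewrite -pure_tensorDr !add0r. Qed.

Lemma pure_tensorZ a (m : M) (n : N) :
  pure_tensor (a *: m) n = pure_tensor m (a *: n).
Proof. by apply: tensor_class_eq; exact: tensor_Z. Qed.

End TensorFacts.

(** * Flatness under base change *)

Section BaseChange.
Variables (A B : comNzRingType) (phi : {rmorphism A -> B}).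
Variables (M : lmodType A) (M' : lmodType B).
Variable h : {linear M -> restrict phi M'}.
Local Notation BA := (restrict phi B^o).
Local Notation act L n :=
  (@orbit_map A B phi L n : {linear BA -> restrict phi L}).

Lemma act_pure (L : lmodType B) (n : L) x (c : BA) :
  tensor_map M (act L n) (pure_tensor x c) =
  pure_tensor x ((c : B) *: n : restrict phi L).
Proof. by rewrite tensor_map_pure. Qed.

Lemma base_change_map : exists e : {linear tensor M BA -> restrict phi M'},
  forall x (c : BA), e (pure_tensor x c) = (c : B) *: (h x : M').
Proof.
pose b (x : M) (c : BA) : restrict phi M' := (c : B) *: (h x : M').
have bl c : linear (b^~ c).
  move=> a x y; rewrite /b linearP restrictZ [RHS]addrC scalerDr addrC.
  by congr (_ + _); rewrite restrictZ !scalerA mulrC.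
have br x : linear (b x).
  by move=> a c d; rewrite /b scalerDl -scalerA.
by have [e [eE _]] := tensor_universal bl br; exists e.
Qed.

(** If e identifies M (x)_A B with M', then M' (x)_B N and M (x)_A N are
    isomorphic, naturally in N, and flatness of M passes to M'. Concretely, the
    inverse of e followed by the maps c |-> c n gives additive maps psi from
    M' (x)_B N to M (x)_A N. They are natural in N and have left inverses
    theta, so an injective f that is injective after M (x)_A is also injective
    after M' (x)_B. *)
Lemma flat_base_change (e : {linear tensor M BA -> restrict phi M'}) :
    (forall x (c : BA), e (pure_tensor x c) = (c : B) *: (h x : M')) ->
    bijective e ->
  flat M -> flat M'.
Proof.
move=> eE [e' eK e'K] M_flat N N' f f_inj.
have e'D y y' : e' (y + y') = e' y + e' y'.
  by apply: (can_inj eK); rewrite e'K linearD /= !e'K.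
have lift (L : lmodType B) : exists
    psi : {additive tensor M' L -> tensor M (restrict phi L)},
    forall y n, psi (pure_tensor y n) = tensor_map M (act L n) (e' y).
  pose b (y : M') n : tensor M (restrict phi L) :=
    tensor_map M (act L n) (e' y).
  apply: (@tensor_balanced _ _ _ _ b) => [y y' n|y n n'|a y n]; rewrite /b.
  - by rewrite e'D raddfD.
  - elim/tensor_pure_ind: (e' y) => [|x c|t u IHt IHu].
    + by rewrite !raddf0 addr0.
    + by rewrite !act_pure scalerDr pure_tensorDr.
    + by rewrite !linearD /= IHt IHu addrACA.
  - have -> : e' (a *: y) = tensor_map M (act B^o a) (e' y).
      apply: (can_inj eK); rewrite e'K -{1}(e'K y).
      elim/tensor_pure_ind: (e' y) => [|x c|t u IHt IHu].
      + by rewrite !raddf0.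
      + by rewrite act_pure !eE scalerA mulrC.
      + by rewrite !linearD /= IHt IHu.
    elim/tensor_pure_ind: (e' y) => [|x c|t u IHt IHu].
    + by rewrite !raddf0.
    + by rewrite !act_pure scalerA.
    + by rewrite !linearD /= IHt IHu.
have [psi psiE] := lift N; have [psi' psi'E] := lift N'.
have [theta thetaE] : exists
    theta : {additive tensor M (restrict phi N) -> tensor M' N},
    forall x n, theta (pure_tensor x n) = pure_tensor (h x : M') (n : N).
  pose b (x : M) (n : restrict phi N) := pure_tensor (h x : M') (n : N).
  apply: (@tensor_balanced _ _ _ _ b) => [x y n|x n n'|a x n]; rewrite /b.
  - by rewrite raddfD pure_tensorDl.
  - by rewrite pure_tensorDr.
  - by rewrite linearZ pure_tensorZ.
have psiK z : theta (psi z) = z.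
  elim/tensor_pure_ind: z => [|y n|t u IHt IHu]; first by rewrite !raddf0.
    rewrite psiE -{2}(e'K y).
    elim/tensor_pure_ind: (e' y) => [|x c|t u IHt IHu].
    + by rewrite !raddf0; symmetry; exact: pure_tensor0l.
    + by rewrite act_pure thetaE eE pure_tensorZ.
    + rewrite linearD /= raddfD /= IHt IHu linearD; symmetry.
      exact: pure_tensorDl.
  by rewrite !raddfD /= IHt IHu.
pose f_res : {linear restrict phi N -> restrict phi N'} := restrict_map f.
have psi_nat z :
    psi' (tensor_map M' f z) = tensor_map M f_res (psi z).
  elim/tensor_pure_ind: z => [|y n|t u IHt IHu]; first by rewrite !raddf0.
    rewrite tensor_map_pure psiE psi'E.
    elim/tensor_pure_ind: (e' y) => [|x c|t u IHt IHu].
    + by rewrite !raddf0.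
    + by rewrite !act_pure tensor_map_pure /= /restrict_map linearZ.
    + by rewrite !linearD /= IHt IHu.
  by rewrite !raddfD /= IHt IHu.
apply: raddf_inj => z fz0; rewrite -(psiK z).
suff -> : psi z = 0 by rewrite raddf0.
apply: (M_flat _ _ f_res) => //.
by rewrite -psi_nat fz0 !raddf0.
Qed.

End BaseChange.

(** * Fractional ideals and their colon rings *)

Section FractionalIdeals.
Variables (R : idomainType) (I : frac_ideal R).

Lemma colon_tofrac (r : R) : colon_pred I (tofrac r).
Proof. by apply/asboolP => x; exact: frac_idealZ. Qed.

Definition colon_const (r : R) : colon_ring I :=
  Sub (tofrac r) (colon_tofrac r).

Section ExtendScalars.
Variables (F : fieldType) (iota : {rmorphism {fraction R} -> F}).

Definition colon_field (a : colon_ring I) : F := iota (val a).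

Lemma colon_field_zmod : zmod_morphism colon_field.
Proof. by move=> a b; rewrite /colon_field !rmorphB. Qed.

Lemma colon_field_monoid : monoid_morphism colon_field.
Proof. by split=> [|a b]; rewrite /colon_field ?rmorph1 // !rmorphM. Qed.

HB.instance Definition _ :=
  GRing.isZmodMorphism.Build _ _ colon_field colon_field_zmod.
HB.instance Definition _ :=
  GRing.isMonoidMorphism.Build _ _ colon_field colon_field_monoid.

Local Notation FA := (restrict colon_field F^o).

Lemma restrict_fieldZ (a : colon_ring I) (c : F) :
  a *: (c : FA) = iota (val a) * c :> F.
Proof. by []. Qed.

(** A fractional ideal has rank one: with a common denominator d, d x = a and
    d x0 = a0 lie in R, so a0 x = a x0 and
    x (x) c = a0 x (x) c / a0 = x0 (x) a c / a0. *)
Lemma ideal_tensor_field (x0 : ideal_module I) (s : seq (ideal_module I * FA)) :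
    val x0 != 0 ->
  tensor_class s = pure_tensor x0
    ((\sum_(p <- s) (p.2 : F) * iota (val p.1)) / iota (val x0) : FA).
Proof.
move=> x0_neq0; have [d d0 dI] := frac_ideal_denom I.
have IP (x : ideal_module I) : I (val x) by apply/asboolP; exact: valP x.
have [a0 a0E] := dI _ (IP x0).
have a0_neq0 : iota (tofrac a0) != 0.
  by rewrite fmorph_eq0 -a0E mulf_neq0 ?tofrac_eq0.
have d_neq0 : iota (tofrac d) != 0 by rewrite fmorph_eq0 tofrac_eq0.
elim: s => [|[x c] s IHs].
  by rewrite big_nil mul0r pure_tensor0r.
rewrite -cat1s tensor_classD big_cons mulrDl pure_tensorDr IHs; congr (_ + _).
have [a aE] := dI _ (IP x).
have ax : colon_const a0 *: x = colon_const a *: x0.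
  apply: val_inj; rewrite !val_colon_scale !SubK -a0E -aE -!mulrA.
  by rewrite [val x0 * _]mulrC.
have -> : c = colon_const a0 *: ((c : F) / iota (tofrac a0) : FA).
  by rewrite restrict_fieldZ SubK mulrC divfK.
rewrite -[LHS]/(pure_tensor _ _) -pure_tensorZ ax pure_tensorZ.
congr (pure_tensor _ _); rewrite !restrict_fieldZ !SubK /=.
have ? : iota (val x0) != 0 by rewrite fmorph_eq0.
by rewrite -a0E -aE !rmorphM /=; field; apply/andP.
Qed.

End ExtendScalars.

(** As J = (J : J) delta iota(I), the morphism iota maps (I : I) into (J : J),
    and J is the base change of I along it: the natural map from I (x) (J : J)
    to J is onto by assumption, and injective because, by flatness of I, it is
    enough to look at I (x) K with K the quotient field of S. *)
Lemma quasi_stable_ideal_transfer (S : idomainType) (J : frac_ideal S)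
    (iota : {rmorphism {fraction R} -> {fraction S}}) (delta : {fraction S}) :
    nonzero_ideal I -> delta != 0 ->
    (forall x, I x -> J (delta * iota x)) ->
    (forall y, J y -> exists2 x, I x &
      exists2 c, colon_pred J c & y = c * (delta * iota x)) ->
  quasi_stable_ideal I -> quasi_stable_ideal J.
Proof.
move=> [x0 Ix0 x0_neq0] delta_neq0 IJ JI.
have colonIJ (a : colon_ring I) : colon_pred J (iota (val a)).
  apply/asboolP => y /JI[x Ix [c /asboolP Jc ->]].
  rewrite mulrCA; apply: Jc; rewrite mulrCA -rmorphM; apply: IJ.
  by have /asboolP := valP a; apply.
pose phi0 (a : colon_ring I) : colon_ring J := Sub (iota (val a)) (colonIJ a).
have val_phi a : val (phi0 a) = iota (val a) by exact: SubK.
have phi0B : zmod_morphism phi0.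
  by move=> a b; apply: val_inj; rewrite rmorphB !val_phi !rmorphB.
have phi0M : monoid_morphism phi0.
  split; first by apply: val_inj; rewrite val_phi !rmorph1.
  by move=> a b; apply: val_inj; rewrite rmorphM !val_phi !rmorphM.
pose phi : {rmorphism colon_ring I -> colon_ring J} := HB.pack phi0
  (GRing.isZmodMorphism.Build _ _ phi0 phi0B)
  (GRing.isMonoidMorphism.Build _ _ phi0 phi0M).
have h_sub (x : ideal_module I) : ideal_pred J (delta * iota (val x)).
  by apply/asboolP/IJ/asboolP; exact: valP x.
pose h0 (x : ideal_module I) : restrict phi (ideal_module J) :=
  (Sub (delta * iota (val x)) (h_sub x) : ideal_module J).
have val_h x : val (h0 x : ideal_module J) = delta * iota (val x).
  exact: SubK.
have h0_linear : linear h0.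
  move=> a x y; apply: val_inj.
  rewrite [RHS]val_ideal_moduleD [in RHS]val_colon_scale !val_h val_phi.
  by rewrite val_ideal_moduleD val_colon_scale rmorphD rmorphM mulrDr mulrCA.
pose h : {linear ideal_module I -> restrict phi (ideal_module J)} :=
  HB.pack h0 (GRing.isLinear.Build _ _ _ _ h0 h0_linear).
have [e eE] := base_change_map h.
pose BA := restrict phi (colon_ring J)^o.
have e_class (s : seq (ideal_module I * BA)) :
    val (e (tensor_class s) : ideal_module J) =
    delta * \sum_(p <- s) val (p.2 : colon_ring J) * iota (val p.1).
  rewrite tensor_class_sum; elim: s => [|p s IHs].
    by rewrite !big_nil mulr0 raddf0.
  rewrite !big_cons linearD /= mulrDr -IHs [LHS]val_ideal_moduleD.
  by congr (_ + _); rewrite eE val_colon_scale val_h mulrCA.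
pose FA := restrict (colon_field iota : {rmorphism colon_ring I -> _})
  {fraction S}^o.
(* The inclusion of (J : J) in the quotient field, over (I : I). *)
pose j0 (c : BA) : FA := val (c : colon_ring J).
have j0_linear : linear j0.
  by move=> a c d; rewrite /j0 rmorphD rmorphM.
pose j : {linear BA -> FA} :=
  HB.pack j0 (GRing.isLinear.Build _ _ _ _ j0 j0_linear).
have j_inj : injective j by move=> c d /val_inj.
move=> I_flat; have e_inj : injective e.
  apply: raddf_inj => t; elim/tensor_classW: t => s es0.
  apply: (I_flat _ _ j j_inj); rewrite linear0 tensor_mapE.
  have x0P : ideal_pred I x0 by apply/asboolP.
  rewrite (@ideal_tensor_field _ iota (Sub x0 x0P)) ?SubK // big_map /=.
  have /eqP := etrans (esym (e_class s)) (congr1 val es0); rewrite mulf_eq0.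
  by rewrite (negbTE delta_neq0) /= => /eqP ->; rewrite mul0r pure_tensor0r.
have e_surj (y : ideal_module J) : { t | e t = y }.
  apply: cid; have /asboolP/JI[x Ix [c Jc y_eq]] := valP y.
  have xP : ideal_pred I x by apply/asboolP.
  pose cJ : colon_ring J := Sub c Jc.
  exists (@pure_tensor _ (ideal_module I) BA (Sub x xP) cJ).
  by apply: val_inj; rewrite eE val_colon_scale val_h !SubK.
apply: (flat_base_change eE) I_flat.
exists (fun y => sval (e_surj y)) => [t|y]; last exact: svalP (e_surj y).
by apply: e_inj; rewrite (svalP (e_surj _)).
Qed.

End FractionalIdeals.

(** * Localization at a prime *)

Section Localize.
Variables (D : idomainType) (P : prime_idealr D).
Local Notation L := (localization P).

Lemma local_frac_subproof (a s : D) :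
  s \notin P -> local_pred P (tofrac a / tofrac s).
Proof. by move=> Ps; apply/asboolP; exists a, s. Qed.

Definition local_frac (a s : D) (Ps : s \notin P) : L :=
  Sub (tofrac a / tofrac s) (local_frac_subproof a Ps).

Lemma notin_prime1 : (1 : D) \notin P.
Proof. by rewrite idealr1. Qed.

Definition local_const (a : D) : L := local_frac a notin_prime1.

Lemma val_local_const a : val (local_const a) = tofrac a.
Proof. by rewrite SubK rmorph1 divr1. Qed.

Lemma local_const_zmod : zmod_morphism local_const.
Proof.
move=> a b; apply: val_inj.
transitivity (val (local_const a) - val (local_const b)).
  by rewrite !val_local_const rmorphB.
by symmetry; exact: rmorphB.
Qed.

Lemma local_const_monoid : monoid_morphism local_const.
Proof.
split=> [|a b]; apply: val_inj.
  by rewrite val_local_const val_local1 rmorph1.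
by rewrite val_localM !val_local_const rmorphM.
Qed.

HB.instance Definition _ :=
  GRing.isZmodMorphism.Build D L local_const local_const_zmod.
HB.instance Definition _ :=
  GRing.isMonoidMorphism.Build D L local_const local_const_monoid.

Lemma local_const_inj : injective local_const.
Proof.
move=> a b /(congr1 val); rewrite !val_local_const => /eqP.
by rewrite tofrac_eq => /eqP.
Qed.

Lemma local_clear_denom (x : L) : exists a s (Ps : s \notin P),
  x * local_const s = local_const a /\
  local_frac 1 Ps * local_const s = 1.
Proof.
have /asboolP[a [s [Ps xE]]] := valP x.
have s_neq0 := local_denom_neq0 Ps.
exists a, s, Ps; split; apply: val_inj; rewrite val_localM !val_local_const.
  by rewrite xE divfK.
by rewrite SubK divfK // val_local1 rmorph1.
Qed.

End Localize.

Theorem corollary3p10 (D : idomainType) (hD : quasi_stable D)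
    (P : prime_idealr D) : quasi_stable (localization P).
Proof.
move=> J [y0 Jy0 y0_neq0].
pose f : {rmorphism D -> {fraction localization P}} :=
  (@FracField.tofrac (localization P)) \o (@local_const D P).
have f_inj : injective f.
  by move=> a b /eqP; rewrite /= tofrac_eq => /eqP/local_const_inj.
have [iota iotaE] := fraction_extend f_inj.
have [d d_neq0 dJ] := frac_ideal_denom J.
pose delta : {fraction localization P} := (tofrac d)^-1.
have delta_neq0 : delta != 0 by rewrite invr_eq0 tofrac_eq0.
(* I is the set of r in D with r / d in J, the contraction of d J to D. *)
pose I0 (x : {fraction D}) := (exists r, x = tofrac r) /\ J (delta * iota x).
have I0_0 : I0 0.
  split; first by exists 0; rewrite rmorph0.
  by rewrite rmorph0 mulr0; exact: frac_ideal0.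
have I0D x y : I0 x -> I0 y -> I0 (x + y).
  move=> [[r ->] Jr] [[s ->] Js]; split.
    by exists (r + s); rewrite rmorphD.
  by rewrite rmorphD mulrDr; exact: frac_idealD.
have I0Z a x : I0 x -> I0 (tofrac a * x).
  move=> [[r ->] Jr]; split; first by exists (a * r); rewrite rmorphM.
  by rewrite rmorphM mulrCA iotaE; exact: frac_idealZ.
have I0_denom : exists2 c : D, c != 0 &
    forall x, I0 x -> exists r : D, tofrac c * x = tofrac r.
  exists 1; first exact: oner_neq0.
  by move=> x [[r ->] _]; exists r; rewrite rmorph1 mul1r.
pose I := FracIdeal I0_0 I0D I0Z I0_denom.
have JI y : J y -> exists2 x, I x &
    exists2 c, colon_pred J c & y = c * (delta * iota x).
  move=> Jy; have [l dy] := dJ y Jy.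
  have [a [s [Ps [ls inv_s]]]] := local_clear_denom l.
  have y_eq : delta * iota (tofrac a) = tofrac (local_const P s) * y.
    rewrite iotaE /= -ls rmorphM /= -dy /delta.
    by rewrite -mulrA mulKf ?tofrac_eq0 // mulrC.
  (* d y = a / s in D_P, hence a is in I and y = (1 / s) (a / d). *)
  exists (tofrac a).
    by split; [exists a | rewrite y_eq; exact: frac_idealZ].
  exists (tofrac (local_frac 1 Ps)); first exact: colon_tofrac.
  by rewrite y_eq mulrA -rmorphM inv_s rmorph1 mul1r.
have [x0 Ix0 [c _ y0E]] := JI _ Jy0.
have I_neq0 : nonzero_ideal I.
  exists x0 => //; apply: contra_neq y0_neq0 => x00.
  by rewrite y0E x00 rmorph0 !mulr0.
have IJ x : I x -> J (delta * iota x) by case.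
exact: quasi_stable_ideal_transfer I_neq0 delta_neq0 IJ JI (hD I I_neq0).
Qed.
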